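(* Let $L/\mathbb{Q}$ be a Galois extension with $[L:\mathbb{Q}] = 4$. Then for any irrational $v \in L$ there exists a primitive element $\alpha$ of $L$ such that $$\deg_\alpha(v) = [L : \mathbb{Q}(v)].$$
   Context: A primitive element of a number field $L$ of degree $n$ is an $\alpha \in L$ with $\mathbb{Q}(\alpha) = L$. For such $\alpha$, every $v \in L$ can be written uniquely as $v = f(\alpha)$ with $f \in \mathbb{Q}[x]$, $\deg f \leq n-1$; the degree of $v$ with respect to $\alpha$, $\deg_\alpha(v)$, is $\deg f$. *)

(* Defs.v *)
From mathcomp Require Import all_boot all_order all_algebra all_field.

Set Implicit Arguments.
Unset Strict Implicit.
Unset Printing Implicit Defensive.

Import GRing.Theory.
Local Open Scope ring_scope.

Definition primitive_element (L : fieldExtType rat) (a : L) : Prop :=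
  <<1; a>>%VS = fullv.

(* Fadjoin_poly 1 a v is the unique polynomial f over Q (with coefficients
   embedded in L) of degree < [Q(a) : Q] such that v = f(a), for v in Q(a);
   see deg_wrtP. *)
Definition deg_wrt (L : fieldExtType rat) (a v : L) : nat :=
  (size (Fadjoin_poly 1%VS a v)).-1.

Lemma deg_wrt_exists (L : fieldExtType rat) (a v : L) :
  primitive_element a ->
  exists2 f : {poly rat}, (size f <= \dim {:L})%N &
    v = (map_poly (in_alg L) f).[a].
Proof.
move=> pa; have va : v \in <<1%AS; a>>%VS by rewrite pa memvf.
have /polyOver1P[f Df] := Fadjoin_polyOver 1%AS a v.
exists f; last by rewrite -Df Fadjoin_poly_eq.
rewrite -(size_map_poly (in_alg L)) -Df.
apply: leq_trans (size_Fadjoin_poly _ _ _) _.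
by rewrite /adjoin_degree pa dimv1 divn1 prednK // (adim_gt0 {:L}%AS).
Qed.

Lemma deg_wrtP (L : fieldExtType rat) (a v : L) (f : {poly rat}) :
  primitive_element a -> (size f <= \dim {:L})%N ->
  v = (map_poly (in_alg L) f).[a] -> deg_wrt a v = (size f).-1.
Proof.
move=> pa szf Dv; rewrite /deg_wrt -(size_map_poly (in_alg L) f).
rewrite (@Fadjoin_poly_unique _ _ 1%AS a (map_poly (in_alg L) f) v) //.
  by apply/polyOver1P; exists f.
rewrite size_map_poly /adjoin_degree pa dimv1 divn1 prednK //.
exact: (adim_gt0 {:L}%AS).
Qed.

(* Main.v *)
Require Import Defs.
From mathcomp Require Import all_boot all_order all_algebra all_field.
From mathcomp Require Import ring.

Set Implicit Arguments.
Unset Strict Implicit.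
Unset Printing Implicit Defensive.

Import GRing.Theory.

(** If v generates L, take alpha = v. Otherwise K = Q(v) is quadratic and L / K
    is quadratic, so completing the square gives w outside K with w^2 in K.
    Every b * w with b in K^* still has its square in K, and one of w, v * w,
    (1 + v) * w has an irrational square: if w^2 and v^2 are both rational, then
    (1 + v)^2 = 1 + v^2 + 2 v is not. For such an alpha, alpha^2 = p + q v with
    p, q rational and q <> 0, so v = (alpha^2 - p) / q has degree 2 in alpha and
    Q(alpha) contains K properly. *)

Section QuadraticExtensions.

Local Open Scope ring_scope.

(** The polynomial [Fadjoin_poly K w u] has size at most 2, and its coefficients serve as [a] and
    [b]. This is applied over [K] to complete the square and over the rationals to expand
    [alpha ^+ 2] in terms of [v]. *)
Lemma adjoin_degree2P (F : fieldType) (L : fieldExtType F) (K : {subfield L})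
    (w u : L) :
  adjoin_degree K w = 2%N -> u \in <<K; w>>%VS ->
  exists a b, [/\ a \in K, b \in K & u = a + b * w].
Proof.
move=> dKw Ku; have /polyOverP Kp := Fadjoin_polyOver K w u.
exists (Fadjoin_poly K w u)`_0, (Fadjoin_poly K w u)`_1; split=> //.
have le2: (size (Fadjoin_poly K w u) <= 2)%N by rewrite -dKw size_Fadjoin_poly.
rewrite -{1}(Fadjoin_poly_eq Ku) (horner_coef_wide _ le2).
by rewrite !big_ord_recl big_ord0 /= expr0 expr1 mulr1 addr0.
Qed.

(** [adjoin_degree] is a successor of a predecessor, so the quotient of dimensions must be shown
    positive. *)
Lemma adjoin_degree_dim (F : fieldType) (L : fieldExtType F) (K : {subfield L})
    (w : L) :
  adjoin_degree K w = \dim_K <<K; w>>.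
Proof.
by rewrite /adjoin_degree prednK // divn_gt0 ?adim_gt0 // dimvS ?subv_adjoin.
Qed.

(** The dimension of [E] divides 4 and exceeds 2, because [x] makes the inclusion of [K] strict. *)
Lemma quartic_intermediate (F : fieldType) (L : fieldExtType F)
    (K E : {subfield L}) (x : L) :
  \dim {:L} = 4%N -> \dim K = 2%N -> (K <= E)%VS -> x \in E -> x \notin K ->
  E = fullv :> {vspace L}.
Proof.
move=> dL dK sKE Ex Kx; apply/eqP; rewrite eqEdim subvf dL.
have := field_dimS (subvf E); rewrite dL.
have: (2 < \dim E)%N.
  rewrite -dK (ltn_leqif (dimv_leqif_sup sKE)).
  by apply: contra Kx => /subvP; apply.
by case: (\dim E) => [|[|[|[|[|n]]]]].
Qed.

Lemma quadratic_sqrt_generator (L : fieldExtType rat) (K : {subfield L})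
    (x : L) :
  adjoin_degree K x = 2%N -> x \notin K ->
  exists2 w, w \notin K & w ^+ 2 \in K.
Proof.
move=> dKx Kx.
have: x ^+ 2 \in <<K; x>>%VS by rewrite rpredX ?memv_adjoin.
case/(adjoin_degree2P dKx)=> a [b [Ka Kb x2E]].
(* Half the linear coefficient in [x ^+ 2 = a + b * x]. *)
set c := 2^-1 *: b; have Kc: c \in K by rewrite memvZ.
have bE: b = c + c by rewrite -mulr2n -scaler_nat scalerA divff ?scale1r.
exists (x - c); first by rewrite rpredBr.
have ->: (x - c) ^+ 2 = a + c ^+ 2.
  by transitivity (x ^+ 2 - 2 * c * x + c ^+ 2); [ring | rewrite x2E bE; ring].
by rewrite rpredD ?rpredX.
Qed.

Lemma irrational_square_generator (L : fieldExtType rat) (K : {subfield L})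
    (v w : L) :
  v \in K -> v \notin 1%VS -> w \notin K -> w ^+ 2 \in K ->
  exists alpha, [/\ alpha \notin K, alpha ^+ 2 \in K & alpha ^+ 2 \notin 1%VS].
Proof.
move=> Kv Qv Kw Kw2; have [Qw2|Qw2] := boolP (w ^+ 2 \in 1%VS); last by exists w.
have w0: w != 0 by apply: contraNneq Kw => ->; rewrite mem0v.
(* As [w ^+ 2] is a nonzero rational here, [(b * w) ^+ 2] is irrational as soon as [b ^+ 2] is. *)
have scaled b: b \in K -> b ^+ 2 \notin 1%VS ->
    exists alpha, [/\ alpha \notin K, alpha ^+ 2 \in K & alpha ^+ 2 \notin 1%VS].
  move=> Kb Qb2.
  have b0: b != 0 by apply: contraNneq Qb2 => ->; rewrite expr0n mem0v.
  exists (b * w); rewrite exprMn; split.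
  - by apply: contra Kw => Kbw; rewrite -(mulKf b0 w) rpredM ?rpredV.
  - by rewrite rpredM // rpredX.
  - apply: contra Qb2 => Q; rewrite -(mulfK (expf_neq0 2 w0) (b ^+ 2)).
    by apply: (rpredM (s := 1%AS : {subfield L})); rewrite ?rpredV.
have [Qv2|] := boolP (v ^+ 2 \in 1%VS); last exact: scaled.
apply: (scaled (1 + v)); first by rewrite rpredD ?rpred1.
apply: contra Qv => Q.
have ->: v = 2^-1 *: ((1 + v) ^+ 2 - 1 - v ^+ 2).
  have ->: (1 + v) ^+ 2 - 1 - v ^+ 2 = v *+ 2 by ring.
  by rewrite -scaler_nat scalerA mulVf ?scale1r.
by rewrite memvZ // !rpredB // mem1v.
Qed.

End QuadraticExtensions.

Theorem theorem3p1 (L : splittingFieldType rat)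
    (galL : galois 1%VS {:L}%VS) (degL : \dim {:L}%VS = 4)
    (v : L) (irr_v : v \notin 1%VS) :
  exists alpha : L,
    primitive_element alpha /\ deg_wrt alpha v = \dim_(<<1; v>>) {:L}.
Proof.
pose K : {subfield L} := <<1; v>>%AS.
have Kv: v \in K by exact: memv_adjoin.
have [K4|K2]: \dim K = 4 \/ \dim K = 2.
- have := field_dimS (subvf K); rewrite degL.
  have: (1 < \dim K)%N.
    rewrite -[X in (X < _)%N](dimv1 L) (ltn_leqif (dimv_leqif_sup (sub1v K))).
    by apply: contra irr_v => /subvP; apply.
  by case: (\dim K) => [|[|[|[|[|n]]]]] //; [right | left].
- exists v; have pv: primitive_element v.
    by apply/eqP; rewrite eqEdim subvf degL [\dim _]K4.
  (* Here [v] is the value of ['X] at itself, and both degrees are 1. *)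
  split=> //; rewrite (@deg_wrtP _ v v 'X%R) ?size_polyX ?degL //.
    by rewrite [\dim <<1; v>>]K4.
  by rewrite map_polyX hornerX.
have [x Kx]: exists x, x \notin K.
  have [/subvP sLK|/subvPn[x _ Kx]] := boolP ({:L} <= K)%VS; last by exists x.
  have: (\dim {:L} <= \dim K)%N by apply: dimvS; apply/subvP.
  by rewrite degL K2.
have dKx: adjoin_degree K x = 2.
  rewrite adjoin_degree_dim (@quartic_intermediate _ _ K <<K; x>>%AS x) //.
  - by rewrite degL K2.
  - exact: subv_adjoin.
  - exact: memv_adjoin.
have [w Kw Kw2] := quadratic_sqrt_generator dKx Kx.
have [al [Kal Kal2 Qal2]] := irrational_square_generator Kv irr_v Kw Kw2.
have d1v: adjoin_degree 1%AS v = 2 by rewrite adjoin_degree_dim dimv1 divn1.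
have [_ [_ [/vlineP[p ->] /vlineP[q ->] al2E]]] := adjoin_degree2P d1v Kal2.
have q0: q != 0%R.
  by apply: contraNneq Qal2 => q0; rewrite al2E q0 scale0r mul0r addr0 memvZ ?mem1v.
(* Solving [al ^+ 2 = p + q * v] for [v] gives a quadratic polynomial in [al]. *)
pose f : {poly rat} := (q^-1 *: ('X^2 - p%:P))%R.
have vE: v = ((map_poly (in_alg L) f).[al])%R.
  rewrite linearZ /= rmorphB /= map_polyXn map_polyC /= !hornerE al2E.
  by rewrite addrC addKr !mulr_algl scalerA mulVf // scale1r.
have szf: size f = 3 by rewrite size_scale ?invr_eq0 // size_XnsubC.
have pal: primitive_element al.
  apply: (@quartic_intermediate _ _ K <<1; al>>%AS al) => //.
  (* [K] lies in the field generated by [al] because [v = f(al)] does. *)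
  - apply/FadjoinP; split; first exact: sub1v.
    rewrite vE; apply: rpred_horner; last exact: memv_adjoin.
    by apply/polyOverP=> i; rewrite coef_map /= memvZ // rpred1.
  - exact: memv_adjoin.
exists al; split=> //.
(* The degree of [f] is 2, and so is the quotient of 4 by the dimension of [K]. *)
by rewrite (@deg_wrtP _ al v f) ?szf ?degL // [\dim <<1; v>>]K2.
Qed.
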